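(* A graph $G$ supports a $\{C_{-3},C_{+6}\}$-free signing (i.e. there is $\sigma:E(G)\to\{+1,-1\}$ such that $(G,\sigma)$ is $\{C_{-3},C_{+6}\}$-free) if and only if $[\omega_G]=0$ in $H^2(Y_6(G);\mathbb F_2)$. Equivalently, $G$ supports such a signing if and only if, whenever a family $\mathcal T$ of triangles of $G$ and a family $\mathcal H$ of hexagons ($6$-cycles) of $G$ satisfy $$\Bigl(\mathop{\triangle}_{T\in\mathcal T}E(T)\Bigr)\mathbin{\triangle}\Bigl(\mathop{\triangle}_{C\in\mathcal H}E(C)\Bigr)=\varnothing,$$ the number $|\mathcal H|$ is even. Consequently, for every positive integer $n$, $$R_6(n)=\max\{e(G):v(G)=n,\ [\omega_G]=0\text{ in }H^2(Y_6(G);\mathbb F_2)\}=\frac12\,\mathrm{ex}_{\mathrm{adm}}(2n,C_6).$$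
   Context: All graphs are finite and simple; $v(G)$, $e(G)$ are the numbers of vertices and edges. A signed graph is a pair $\widehat G=(G,\sigma)$ with $\sigma:E(G)\to\{+1,-1\}$; the sign of a cycle is the product of its edge signs. A signed graph is $\{C_{-3},C_{+6}\}$-free if it contains no triangle of sign $-1$ and no $6$-cycle of sign $+1$. $R_6(n)=\widehat{\mathrm{ex}}(n,\{C_{-3},C_{+6}\})$ is the maximum number of edges of an $n$-vertex $\{C_{-3},C_{+6}\}$-free signed graph. $Y_6(G)$ is the two-dimensional CW complex obtained from $G$ (as one-skeleton) by attaching one two-cell along every triangle and every $6$-cycle (simple cycle of length $6$) of $G$. The cellular cochain $\omega_G\in C^2(Y_6(G);\mathbb F_2)$ takes value $0$ on each triangle-cell and $1$ on each hexagon-cell; $[\omega_G]$ is its class in $H^2(Y_6(G);\mathbb F_2)$. Families of triangles and hexagons are sets of such subgraphs, and $\triangle$ denotes symmetric difference. A fixed-point-free involutory automorphism $\tau$ of a graph $D$ is admissible if (i) $v\tau(v)\notin E(D)$ for every $v\in V(D)$, and (ii) no two distinct $\tau$-orbits $\{u,\tau(u)\}$, $\{w,\tau(w)\}$ have all four possible edges between them in $D$. For even $N$, $\mathrm{ex}_{\mathrm{adm}}(N,C_6)$ is the maximum number of edges in an $N$-vertex graph that contains no $6$-cycle and has an admissible involution. *)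

(* Defs.v *)
From HB Require Import structures.
From mathcomp Require Import all_boot all_order all_algebra all_fingroup.

Set Implicit Arguments.
Unset Strict Implicit.
Unset Printing Implicit Defensive.

Import GRing.Theory.

Local Open Scope ring_scope.

(* A finite simple graph on V is given by its set of edges, each edge being
   the two-element set of its ends. *)
Record sgraph (V : finType) := SGraph {
  edges : {set {set V}};
  edges_card2 : [forall e in edges, #|e| == 2]
}.

HB.instance Definition _ (V : finType) := [isSub for @edges V].
HB.instance Definition _ (V : finType) := [Finite of sgraph V by <:].

Notation "'E(' G )" := (edges G) (at level 0, format "'E(' G )").

Definition adj (V : finType) (G : sgraph V) (u v : V) : bool :=
  [set u; v] \in E(G).

Definition edge (V : finType) (G : sgraph V) : finType :=
  {e : {set V} | e \in E(G)}.

Definition cycle_edges (V : finType) (c : seq V) : {set {set V}} :=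
  [set [set x; next c x] | x in c].

(* The simple cycles of length k >= 3 of G. A cycle, as a subgraph, is
   determined by its edge set and is identified with it; in particular cyclic
   shifts and reversals of the same vertex sequence give one and the same
   cycle. *)
Definition cycles (V : finType) (G : sgraph V) (k : nat) :
    {set {set {set V}}} :=
  [set C | [exists c : k.-tuple V,
     [&& uniq c, C == cycle_edges c & C \subset E(G)]]].

Definition triangles (V : finType) (G : sgraph V) := cycles G 3.
Definition hexagons (V : finType) (G : sgraph V) := cycles G 6.

Definition pm1 : finType := seq_sub [:: 1; -1 : int].

Definition signing (V : finType) (G : sgraph V) : finType :=
  {ffun edge G -> pm1}.

Definition signed_graph (V : finType) : finType :=
  {G : sgraph V & signing G}.

Definition cycle_sign (V : finType) (G : sgraph V) (sigma : signing G)
    (C : {set {set V}}) : int :=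
  \prod_(e : edge G | val e \in C) val (sigma e).

Definition is_free (V : finType) (G : sgraph V) (sigma : signing G) : bool :=
  [forall C in triangles G, cycle_sign sigma C != -1]
  && [forall C in hexagons G, cycle_sign sigma C != 1].

Definition supports_free_signing (V : finType) (G : sgraph V) : Prop :=
  exists sigma : signing G, is_free sigma.

Definition R6 (n : nat) : nat :=
  \max_(S : signed_graph 'I_n | is_free (tagged S)) #|E(tag S)|.

(* The complex Y_6(G) is represented by its cells and its mod 2 incidence
   numbers, that is by its cellular cochain complex. *)

Definition face (V : finType) (G : sgraph V) : finType :=
  ({T | T \in triangles G} + {C | C \in hexagons G})%type.

Definition boundary (V : finType) (G : sgraph V) (c : face G) :
    {set {set V}} :=
  match c with inl T => val T | inr C => val C end.

Definition cochain (X : finType) := {ffun X -> 'F_2}.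

HB.instance Definition _ (X : finType) := GRing.Zmodule.on (cochain X).
HB.instance Definition _ (X : finType) := Finite.on (cochain X).
HB.instance Definition _ (X : finType) := [finGroupMixin of cochain X for +%R].

(* The coboundary C^1 -> C^2. A face is attached along a simple cycle, so its
   mod 2 incidence number with an edge e is 1 if e lies on that cycle, and 0
   otherwise. *)
Definition coboundary (V : finType) (G : sgraph V) (x : cochain (edge G)) :
    cochain (face G) :=
  [ffun c => \sum_(e : edge G | val e \in boundary c) x e].

Definition B2_set (V : finType) (G : sgraph V) : {set cochain (face G)} :=
  [set coboundary x | x : cochain (edge G)].

Lemma B2_group_set (V : finType) (G : sgraph V) : group_set (B2_set G).
Proof.
apply/group_setP; split=> [|a b /imsetP[x _ ->] /imsetP[y _ ->]].
  apply/imsetP; exists 0 => //; apply/ffunP=> c.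
  by rewrite [RHS]ffunE [LHS]ffunE big1 // => e _; rewrite ffunE.
apply/imsetP; exists (x + y) => //; apply/ffunP=> c.
rewrite [LHS]ffunE 2![in LHS]ffunE [RHS]ffunE -big_split /=.
by apply: eq_bigr => e _; rewrite ffunE.
Qed.

Definition B2 (V : finType) (G : sgraph V) : {group cochain (face G)} :=
  Group (B2_group_set G).

(* There are no cells of dimension 3, so every 2-cochain is a cocycle and H^2
   is the quotient of the abelian group of all 2-cochains by B^2. Quotient
   groups are written multiplicatively: the zero class is 1%g. *)
Definition H2 (V : finType) (G : sgraph V) : finGroupType := coset_of (B2 G).

Definition cohomology_class (V : finType) (G : sgraph V)
    (c : cochain (face G)) : H2 G := coset (B2 G) c.

Definition omega (V : finType) (G : sgraph V) : cochain (face G) :=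
  [ffun c : face G => if c is inr _ return 'F_2 then 1 else 0].

Definition symdiff (X : finType) (A B : {set X}) : {set X} :=
  (A :\: B) :|: (B :\: A).

Definition big_symdiff (X : finType) (F : {set {set X}}) : {set X} :=
  \big[@symdiff X/set0]_(A in F) A.

Definition admissible (V : finType) (D : sgraph V) (tau : {perm V}) : bool :=
  [&& [forall u, forall v, adj D (tau u) (tau v) == adj D u v],
      [forall v, tau (tau v) == v],
      [forall v, tau v != v],
      [forall v, ~~ adj D v (tau v)]
    & [forall u, forall w, ([set u; tau u] != [set w; tau w]) ==>
        ~~ [&& adj D u w, adj D u (tau w), adj D (tau u) w
             & adj D (tau u) (tau w)]]].

(* Meaningful for even N only: for odd N no graph qualifies and the maximum
   over the empty family is 0. *)
Definition ex_adm_C6 (N : nat) : nat :=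
  \max_(D : sgraph 'I_N |
        (hexagons D == set0) && [exists tau : {perm 'I_N}, admissible D tau])
    #|E(D)|.

(* Main.v *)
(* Let N be the set of negative edges of a signing. The signing is free iff
   |C :&: N| is even for every triangle C and odd for every hexagon C; over F_2
   this says that the indicator of N has coboundary omega_G, and the criterion on
   families of cycles is the Fredholm alternative for this linear system.
   For the extremal numbers, a signing of G amounts to a double cover of G, with
   twice as many edges. A hexagon of the cover projects to a positive closed walk
   that never backtracks, hence to a positive hexagon or to two negative
   triangles sharing a vertex; conversely positive hexagons and doubled negative
   triangles lift to hexagons. Double covers are exactly the graphs with an
   admissible involution, condition (ii) ruling out both lifts of an edge
   occurring together. *)

Require Import Defs.
From mathcomp Require Import all_boot all_order all_algebra all_fingroup.

Set Implicit Arguments.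
Unset Strict Implicit.
Unset Printing Implicit Defensive.

Import GRing.Theory.

Local Open Scope ring_scope.

(** * Cycles as edge sets *)

Lemma next_next_neq (T : eqType) (c : seq T) (x : T) :
  uniq c -> (2 < size c)%N -> x \in c -> next c (next c x) != x.
Proof.
move=> Uc sc cx; have [i s def_c] := rot_to cx.
rewrite -!(next_rot i Uc) def_c; have: uniq (rot i c) by rewrite rot_uniq.
have: (2 < size (rot i c))%N by rewrite size_rot.
rewrite def_c; case: s {def_c} => [|y [|z s]] //= _.
rewrite !inE !negb_or eqxx => /andP[/and3P[/negPf nxy /negPf nxz _] _].
by rewrite !eqxx (eq_sym y) nxy eq_sym nxz.
Qed.

(** Two vertices giving the same edge would be each other's successors, which [next_next_neq]
    excludes. Operations over the edges of a cycle can thus be carried out along its vertex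
    sequence. *)
Lemma next_edge_inj (V : finType) (c : seq V) :
  uniq c -> (2 < size c)%N ->
  {in c &, injective (fun x => [set x; next c x])}.
Proof.
move=> Uc sc x y cx cy /setP exy; apply/eqP; apply: contraT => nxy.
have := exy x; rewrite !inE eqxx (negPf nxy) /= => /esym/eqP x_ny.
have := exy y; rewrite !inE eqxx eq_sym (negPf nxy) /= => /eqP y_nx.
by have := next_next_neq Uc sc cx; rewrite -y_nx -x_ny eqxx.
Qed.

Lemma big_cycle_edges (R : Type) (idx : R) (op : Monoid.com_law idx)
    (V : finType) (c : seq V) (F : {set V} -> R) :
  uniq c -> (2 < size c)%N ->
  \big[op/idx]_(e in cycle_edges c) F e
    = \big[op/idx]_(x <- c) F [set x; next c x].
Proof.
move=> Uc sc; rewrite big_imset; last exact: next_edge_inj.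
by rewrite [RHS]big_uniq.
Qed.

Lemma card_cycle_edges (V : finType) (c : seq V) :
  uniq c -> (2 < size c)%N -> #|cycle_edges c| = size c.
Proof.
by move=> Uc sc; rewrite card_in_imset ?(card_uniqP _) //; apply: next_edge_inj.
Qed.

Lemma cyclesP (V : finType) (G : sgraph V) (k : nat) (C : {set {set V}}) :
  reflect (exists c : seq V,
             [/\ size c = k, uniq c, path.cycle (adj G) c & C = cycle_edges c])
          (C \in cycles G k).
Proof.
rewrite inE; apply: (iffP existsP) => -[c].
  case/and3P=> Uc /eqP-> /subsetP cG; exists c; split; rewrite ?size_tuple //.
  by apply: cycle_from_next => // x cx; apply: cG; apply: imset_f.
case=> /eqP sc Uc cG ->; exists (Tuple sc); rewrite Uc eqxx /=.
by apply/subsetP=> _ /imsetP[x cx ->]; apply: next_cycle cG cx.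
Qed.

Lemma cycles_sub (V : finType) (G : sgraph V) k C :
  C \in cycles G k -> C \subset E(G).
Proof. by rewrite inE => /existsP[c /and3P[_ _]]. Qed.

Lemma card_cycle (V : finType) (G : sgraph V) k C :
  (2 < k)%N -> C \in cycles G k -> #|C| = k.
Proof.
by move=> k_gt2 /cyclesP[c [sc Uc _ ->]]; rewrite card_cycle_edges ?sc.
Qed.

Lemma triangles_hexagons_disjoint (V : finType) (G : sgraph V) :
  [disjoint triangles G & hexagons G].
Proof.
apply/pred0P=> C; apply/negbTE/andP=> -[/card_cycle C3 /card_cycle C6].
by have := C3 isT; rewrite C6.
Qed.

(** * Parities, and signings as sets of negative edges *)

Lemma odd_card_setI (X : finType) (A N : {set X}) :
  odd #|A :&: N| = \big[addb/false]_(x in A) (x \in N).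
Proof.
rewrite -sum1_card (big_morph odd oddD (erefl : odd 0 = false)).
rewrite (eq_bigl _ _ (fun x => in_setI x A N)) big_mkcondr.
by apply: eq_bigr => x _; case: (x \in N).
Qed.

Lemma in_symdiff (X : finType) (A B : {set X}) x :
  (x \in symdiff A B) = (x \in A) (+) (x \in B).
Proof. by rewrite !inE; do 2!case: (x \in _). Qed.

Lemma in_big_symdiff (X : finType) (F : {set {set X}}) x :
  (x \in big_symdiff F) = \big[addb/false]_(A in F) (x \in A).
Proof.
by apply: (big_morph (fun A : {set X} => x \in A)) => [A B|];
   rewrite ?in_symdiff ?inE.
Qed.

(* [N] plays the role of the set of negative edges. *)
Definition negative_free (V : finType) (G : sgraph V) (N : {set {set V}}) :=
  (forall C, C \in triangles G -> ~~ odd #|C :&: N|) /\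
  (forall C, C \in hexagons G -> odd #|C :&: N|).

Lemma big_edge (R : Type) (idx : R) (op : Monoid.com_law idx)
    (V : finType) (G : sgraph V) (C : {set {set V}}) (F : {set V} -> R) :
  C \subset E(G) ->
  \big[op/idx]_(e : edge G | val e \in C) F (val e) = \big[op/idx]_(e in C) F e.
Proof.
move=> /subsetP CG; rewrite -big_sub_cond; apply: eq_bigl => e.
by rewrite andb_idl //; apply: CG.
Qed.

Lemma cycle_sign_negative (V : finType) (G : sgraph V) (sigma : signing G)
    (N : {set {set V}}) (C : {set {set V}}) :
  C \subset E(G) ->
  (forall e, val (sigma e) = if val e \in N then -1 else 1) ->
  cycle_sign sigma C = (-1) ^+ odd #|C :&: N|.
Proof.
move=> CG sN; rewrite /cycle_sign (eq_bigr _ (fun e _ => sN e)).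
rewrite (big_edge _ (fun e => if e \in N then -1 else 1 : int) CG).
rewrite odd_card_setI (big_morph (fun b : bool => (-1) ^+ b) (@signr_addb _) (erefl _)).
by apply: eq_bigr => e _; case: (e \in N).
Qed.

Lemma is_free_negative (V : finType) (G : sgraph V) (sigma : signing G)
    (N : {set {set V}}) :
  (forall e, val (sigma e) = if val e \in N then -1 else 1) ->
  is_free sigma <-> negative_free G N.
Proof.
move=> sN; rewrite /negative_free; split=> [/andP[/forall_inP fT /forall_inP fH]|[fT fH]].
  split=> C CG; [move: (fT C CG) | move: (fH C CG)];
    by rewrite (cycle_sign_negative (cycles_sub CG) sN); case: odd.
by apply/andP; split; apply/forall_inP=> C CG;
   [move: (fT C CG) | move: (fH C CG)];
   rewrite (cycle_sign_negative (cycles_sub CG) sN); case: odd.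
Qed.

(** Here [N] may contain sets that are not edges of [G]: it is only ever intersected with cycles of
    [G]. *)
Lemma supports_negative (V : finType) (G : sgraph V) :
  supports_free_signing G <-> exists N, negative_free G N.
Proof.
split=> [[sigma fr]|[N fr]].
  exists [set val e | e in [set e : edge G | val (sigma e) == -1]].
  apply: (proj1 (is_free_negative _)) fr => e; rewrite mem_imset ?inE; last exact: val_inj.
  case: ifP => [/eqP //|]; have := valP (sigma e).
  by rewrite !inE => /orP[/eqP//|->].
have p1 : 1 \in [:: 1; -1 : int] by [].
have m1 : -1 \in [:: 1; -1 : int] by [].
exists [ffun e : edge G => if val e \in N then SeqSub m1 else SeqSub p1 : pm1].
by apply: (proj2 (is_free_negative _)) fr => e; rewrite ffunE; case: ifP.
Qed.

(** * The coboundary equation for [omega] *)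

Lemma coboundary_negative (V : finType) (G : sgraph V) (x : cochain (edge G))
    (N : {set {set V}}) (c : face G) :
  (forall e, x e = (val e \in N)%:R) ->
  coboundary x c = (odd #|boundary c :&: N|)%:R.
Proof.
move=> xN; rewrite ffunE (eq_bigr _ (fun e _ => xN e)).
have cG : boundary c \subset E(G) by case: c => -[C CG]; apply: cycles_sub CG.
rewrite (big_edge _ (fun e => (e \in N)%:R) cG) odd_card_setI.
rewrite (big_morph (fun b : bool => b%:R : 'F_2) (_ : {morph _ : a b / a (+) b >-> a + b}) (erefl _)) //.
by move=> [] [] //; apply/val_inj.
Qed.

Lemma coboundary_omega (V : finType) (G : sgraph V) (x : cochain (edge G))
    (N : {set {set V}}) :
  (forall e, x e = (val e \in N)%:R) ->
  coboundary x = omega G <-> negative_free G N.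
Proof.
move=> xN; split=> [/ffunP xo | [fT fH]].
  split=> C CG; [have := xo (inl (exist _ C CG)) | have := xo (inr (exist _ C CG))];
  by rewrite (coboundary_negative _ xN) [omega _ _]ffunE /=; case: odd.
apply/ffunP=> c; rewrite (coboundary_negative _ xN) ffunE.
by case: c => -[C CG] /=; [rewrite (negPf (fT C CG)) | rewrite fH].
Qed.

Lemma coset_B2_eq1 (V : finType) (G : sgraph V) (c : cochain (face G)) :
  cohomology_class c = 1%g <-> exists x : cochain (edge G), coboundary x = c.
Proof.
split=> [/coset_idr c1|[x <-]]; last by apply: coset_id; apply: imset_f.
have /imsetP[x _ ->] : c \in B2 G; last by exists x.
(* [coset] also sends everything outside the normaliser to 1, so normality must be checked; it holds
   because the cochain group is abelian. *)
apply: c1; apply: (subsetP (cents_norm _) c (in_setT c)).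
by apply/centsP=> a _ b _; apply: addrC.
Qed.

Lemma cohomology_negative (V : finType) (G : sgraph V) :
  cohomology_class (omega G) = 1%g <-> exists N, negative_free G N.
Proof.
apply: iff_trans (coset_B2_eq1 _) _; split=> [[x xo]|[N fr]].
  exists [set val e | e in [set e : edge G | x e == 1]].
  apply: (proj1 (coboundary_omega _)) xo => e.
  rewrite mem_imset ?inE; last exact: val_inj.
  by case: (x e) => -[|[|]] // i; apply/val_inj.
exists [ffun e : edge G => (val e \in N)%:R].
by apply: (proj2 (coboundary_omega _)) fr => e; rewrite ffunE.
Qed.

(** * Solvability of parity systems over ['F_2] *)

Lemma natrF2_addb : {morph (fun b : bool => b%:R : 'F_2) : a b / a (+) b >-> a + b}.
Proof. by move=> [] [] //; apply/val_inj. Qed.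

Lemma natrF2_inj : injective (fun b : bool => b%:R : 'F_2).
Proof. by move=> [] []. Qed.

Lemma natrF2_neq0 (a : 'F_2) : a = (a != 0)%:R.
Proof. by case: a => -[|[|]] // i; apply/val_inj. Qed.

Lemma big_addb_natr (I : finType) (P b : pred I) :
  (\big[addb/false]_(i | P i) b i)%:R = \sum_(i | P i) (b i)%:R :> 'F_2.
Proof. exact: (big_morph (fun b : bool => b%:R : 'F_2) natrF2_addb (erefl _)). Qed.

(** The indicator of [N] is the unknown and each member of [F] gives one equation. A family [K] with
    empty symmetric difference is a linear dependency between the left-hand sides, and the
    right-hand sides must satisfy it too. *)
Lemma parity_solvable (X : finType) (F H : {set {set X}}) :
  (exists N : {set X}, forall C, C \in F -> odd #|C :&: N| = (C \in H)) <->
  (forall K : {set {set X}}, K \subset F -> big_symdiff K = set0 ->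
     ~~ odd #|K :&: H|).
Proof.
split=> [[N NF] K /subsetP KF K0|all_even].
  (* Count the pairs of [x] and [C] in [K] with [x] in [C :&: N] modulo 2. Summing over [C] gives
     the parity of [K :&: H]; summing over [x] gives 0, since each [x] lies in an even number of
     members of [K]. *)
  rewrite odd_card_setI -(eq_bigr _ (fun C CK => NF C (KF C CK))).
  rewrite (eq_bigr (fun C : {set X} => \big[addb/false]_x ((x \in C) && (x \in N)))); last first.
    by move=> C _; rewrite odd_card_setI big_mkcond; apply: eq_bigr => x _; case: ifP.
  rewrite exchange_big big1 // => x _.
  have Kx := in_big_symdiff K x; rewrite K0 inE in Kx.
  case: (x \in N); first by under eq_bigr do rewrite andbT; rewrite -Kx.
  by rewrite big1 // => C _; rewrite andbF.
(* Columns range over all subsets of [X], those outside [F] being zero. A row [u] with [u *m M = w]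
   is the indicator of the required set. *)
pose M := \matrix_(i < #|X|, j < #|{set X}|)
  ((enum_val i \in enum_val j) && (enum_val j \in F))%:R : 'M['F_2]_(_, _).
pose w := \row_(j < #|{set X}|)
  ((enum_val j \in F) && (enum_val j \in H))%:R : 'rV['F_2]_#|{set X}|.
have /submxP[u wE] : (w <= M)%MS.
  rewrite submxE; apply/eqP/rowP=> k; rewrite mxE [RHS]mxE.
  (* It remains to show that [w] annihilates each column of the cokernel of [M]. Such a column is a
     dependency between the columns of [M], and [K] is its support within [F]. *)
  pose K := [set C in F | cokermx M (enum_rank C) k != 0].
  have := all_even K; rewrite odd_card_setI => Keven.
  rewrite (reindex _ (onW_bij _ (@enum_rank_bij _))) /=.
  transitivity ((\big[addb/false]_(C in K) (C \in H))%:R : 'F_2); last first.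
    rewrite (negPf (Keven _ _)) //; first by apply/subsetP=> C; rewrite inE => /andP[].
    apply/setP=> x; rewrite in_big_symdiff inE; apply: natrF2_inj => /=.
    rewrite big_addb_natr big_mkcond /=.
    have /matrixP/(_ (enum_rank x) k) := mulmx_coker M.
    rewrite !mxE (reindex _ (onW_bij _ (@enum_rank_bij _))) /= => Mk0.
    apply: etrans Mk0; apply: eq_bigr => C _; rewrite mxE !enum_rankK inE [in RHS](natrF2_neq0 (cokermx _ _ _)).
    by do 2!case: (_ \in _) => /=; rewrite ?mul0r ?mul1r //; case: ifP.
  rewrite big_addb_natr [RHS]big_mkcond /=.
  apply: eq_bigr => C _; rewrite mxE !enum_rankK inE [in LHS](natrF2_neq0 (cokermx _ _ _)).
  case: (C \in F); rewrite /= ?mul0r //.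
  by case: ifP; rewrite ?mulr1 ?mulr0.
exists [set x | u ord0 (enum_rank x) != 0] => C CF.
have /rowP/(_ (enum_rank C)) := wE; rewrite !mxE enum_rankK CF /= => CH.
apply: natrF2_inj => /=; rewrite CH odd_card_setI big_addb_natr big_mkcond /=.
rewrite [RHS](reindex _ (onW_bij _ (@enum_rank_bij _))); apply: eq_bigr => x _.
rewrite mxE !enum_rankK CF inE [in RHS](natrF2_neq0 (u _ _)) andbT.
by case: (x \in C); rewrite ?mulr1 ?mulr0.
Qed.

(** Disjointness of triangles and hexagons merges the two conditions into one parity system, to
    which [parity_solvable] applies. *)
Lemma negative_free_parity (V : finType) (G : sgraph V) (N : {set {set V}}) :
  negative_free G N <->
  (forall C, C \in triangles G :|: hexagons G ->
     odd #|C :&: N| = (C \in hexagons G)).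
Proof.
split=> [[fT fH] C|NF].
  rewrite inE; case CH: (C \in hexagons G); first by move=> _; apply: fH.
  by rewrite orbF => /fT/negPf.
split=> C CG; last by rewrite NF // in_setU CG orbT.
by rewrite NF ?in_setU ?CG // (disjointFr (triangles_hexagons_disjoint G) CG).
Qed.

Lemma big_symdiff_setU (X : finType) (K L : {set {set X}}) :
  [disjoint K & L] ->
  big_symdiff (K :|: L) = symdiff (big_symdiff K) (big_symdiff L).
Proof.
move=> KL; apply/setP=> x; rewrite in_symdiff !in_big_symdiff -bigU //.
by apply: eq_bigl => A; rewrite !inE.
Qed.

Lemma negative_families (V : finType) (G : sgraph V) :
  (exists N, negative_free G N) <->
  (forall Ts Hs : {set {set {set V}}},
     Ts \subset triangles G -> Hs \subset hexagons G ->
     symdiff (big_symdiff Ts) (big_symdiff Hs) = set0 -> ~~ odd #|Hs|).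
Proof.
have TH := triangles_hexagons_disjoint G.
have [solv1 solv2] := parity_solvable (triangles G :|: hexagons G) (hexagons G).
split=> [[N /negative_free_parity NF] Ts Hs sT sH|fam].
  have dTH : [disjoint Ts & Hs] by apply: disjointWl sT (disjointWr sH TH).
  rewrite -big_symdiff_setU // => /(solv1 (ex_intro _ N NF) (Ts :|: Hs) (setUSS sT sH)).
  rewrite setIUl (setIidPl sH) (_ : Ts :&: _ = set0) ?set0U //.
  by apply/eqP; rewrite setI_eq0; apply: disjointWl sT TH.
have [|N NF] := solv2; last by exists N; apply/negative_free_parity.
move=> K KF K0; apply: (fam (K :&: triangles G)); rewrite ?subsetIr //.
rewrite -big_symdiff_setU -?setIUr ?(setIidPl KF) //.
by apply: disjointWl (subsetIr _ _) (disjointWr (subsetIr _ _) TH).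
Qed.

(** * Voltages on ordered pairs of vertices *)

Lemma map_next (T : eqType) (c : seq T) : uniq c -> map (next c) c = rot 1 c.
Proof.
case: c => // x s Uc; apply: (@eq_from_nth _ x); rewrite size_map ?size_rot //.
move=> i si; rewrite (nth_map x) // next_nth mem_nth // index_uniq //.
rewrite rot1_cons nth_rcons; case: ltngtP => // si'; rewrite nth_default //.
  exact: ltnW.
by rewrite si'.
Qed.

Lemma big_zip_map (R : Type) (idx : R) (op : Monoid.law idx) (T : Type)
    (c : seq T) (h : T -> T) (F : T -> T -> R) :
  \big[op/idx]_(x <- c) F x (h x)
    = \big[op/idx]_(q <- zip c (map h c)) F q.1 q.2.
Proof. by elim: c => [|x c IHc] /=; rewrite ?big_nil // !big_cons IHc. Qed.

Lemma eq_set2 (T : finType) (a b c d : T) :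
  ([set a; b] == [set c; d]) = ((a, b) == (c, d)) || ((a, b) == (d, c)).
Proof.
rewrite !xpair_eqE; apply/eqP/orP=> [/setP eab | [] /andP[/eqP-> /eqP->] //].
  have := (eab a, eab b, eab c, eab d); rewrite !inE !eqxx !orbT /=.
  case=> [[[/esym/orP ha /esym/orP hb] /orP hc] /orP hd].
  by case: ha hb hc hd => /eqP ? [] /eqP ? [] /eqP ? [] /eqP ?; subst;
     rewrite !eqxx; (left + right).
exact: setUC.
Qed.

(** A closed walk of length 3 in a simple graph is automatically a triangle, whereas one of length 6
    may repeat vertices; hence [uniq] only in the second clause. *)
Definition free_voltage (V : finType) (G : sgraph V) (s : rel V) :=
  (forall a b c, path.cycle (adj G) [:: a; b; c] ->
     s a b (+) s b c (+) s c a = false) /\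
  (forall a b c d e f, uniq [:: a; b; c; d; e; f] ->
     path.cycle (adj G) [:: a; b; c; d; e; f] ->
     s a b (+) s b c (+) s c d (+) s d e (+) s e f (+) s f a).

Lemma adj_sym (V : finType) (G : sgraph V) : symmetric (adj G).
Proof. by move=> u v; rewrite /adj setUC. Qed.

Lemma adj_irr (V : finType) (G : sgraph V) : irreflexive (adj G).
Proof.
move=> u; apply/negbTE/negP=> uu.
by have /forall_inP/(_ _ uu) := edges_card2 G; rewrite setUid cards1.
Qed.

Lemma adj_neq (V : finType) (G : sgraph V) u v : adj G u v -> u != v.
Proof. by apply: contraTneq => ->; rewrite adj_irr. Qed.

(** With [zip] and [rot] in place of [next], the sum unfolds by computation on an explicit list of
    vertices. *)
Lemma odd_cycle_voltage (V : finType) (N : {set {set V}}) (s : rel V) c :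
  (forall u v, ([set u; v] \in N) = s u v) -> uniq c -> (2 < size c)%N ->
  odd #|cycle_edges c :&: N|
    = \big[addb/false]_(q <- zip c (rot 1 c)) s q.1 q.2.
Proof.
move=> Ns Uc sc; rewrite odd_card_setI big_cycle_edges //.
by under eq_bigr do rewrite Ns; rewrite (big_zip_map _ _ (next c) s) map_next.
Qed.

Lemma negative_free_voltage (V : finType) (G : sgraph V) (N : {set {set V}})
    (s : rel V) :
  (forall u v, ([set u; v] \in N) = s u v) ->
  negative_free G N <-> free_voltage G s.
Proof.
move=> Ns; split=> -[fT fH]; split.
- move=> a b c abc.
  have Uc : uniq [:: a; b; c].
    case/and4P: abc => /adj_neq nab /adj_neq nbc /adj_neq nca _.
    by rewrite /= !inE negb_or nab nbc eq_sym nca.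
  have := fT (cycle_edges [:: a; b; c]).
  rewrite (odd_cycle_voltage Ns) // /rot /= !big_cons big_nil /= addbF addbA => /(_ _)/negbTE; apply.
  by apply/cyclesP; exists [:: a; b; c].
- move=> a b c d e f Uc cG.
  have := fH (cycle_edges [:: a; b; c; d; e; f]).
  rewrite (odd_cycle_voltage Ns) // /rot /= !big_cons big_nil /= addbF !addbA; apply.
  by apply/cyclesP; exists [:: a; b; c; d; e; f].
- move=> _ /cyclesP[[|a [|b [|c [|? ?]]]] [] // _ Uc /fT abc ->].
  by rewrite (odd_cycle_voltage Ns) // /rot /= !big_cons big_nil /= addbF addbA abc.
move=> _ /cyclesP[[|a [|b [|c [|d [|e [|f [|? ?]]]]]]] [] // _ Uc /(fH _ _ _ _ _ _ Uc) abc ->].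
by rewrite (odd_cycle_voltage Ns) // /rot /= !big_cons big_nil /= addbF !addbA abc.
Qed.

Lemma negative_voltage (V : finType) (G : sgraph V) :
  (exists N, negative_free G N) <->
  exists2 s : rel V, symmetric s & free_voltage G s.
Proof.
split=> [[N NG] | [s s_sym sG]].
  exists (fun u v => [set u; v] \in N); first by move=> u v; rewrite setUC.
  exact: (proj1 (negative_free_voltage _ (fun u v => erefl))) NG.
exists [set [set q.1; q.2] | q in [set q | s q.1 q.2]].
apply: (proj2 (negative_free_voltage _ _)) sG => u v.
apply/imsetP/idP=> [[[a b]] | suv]; last by exists (u, v); rewrite ?inE.
by rewrite inE /= => sab /eqP; rewrite eq_set2 /= => /orP[] /eqP[-> ->]; rewrite // s_sym.
Qed.

(** * Double covers: edge counts and hexagons *)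

Lemma rel_graph (V : finType) (r : rel V) :
  symmetric r -> irreflexive r -> exists G : sgraph V, adj G =2 r.
Proof.
move=> r_sym r_irr.
pose E := [set [set q.1; q.2] | q in [set q | r q.1 q.2]].
have E2 : [forall e in E, #|e| == 2].
  apply/forall_inP=> _ /imsetP[[a b] rab ->]; rewrite inE /= in rab.
  by rewrite /= cards2 (contraTneq _ rab) // => ->; rewrite r_irr.
exists (SGraph E2) => u v; rewrite /adj /=.
apply/imsetP/idP=> [[[a b]] | ruv]; last by exists (u, v); rewrite ?inE.
by rewrite inE /= => rab /eqP; rewrite eq_set2 /= => /orP[] /eqP[-> ->]; rewrite // r_sym.
Qed.

(** Sorted by underlying edge, the arcs fall into fibres consisting of [(a, b)] and [(b, a)]. *)
Lemma card_arcs (V : finType) (G : sgraph V) :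
  #|[set q | adj G q.1 q.2]| = (#|E(G)| * 2)%N.
Proof.
rewrite -sum1_card (partition_big (fun q => [set q.1; q.2]) (mem E(G))) /=; last first.
  by move=> q; rewrite inE.
rewrite -sum_nat_const; apply: eq_bigr => e eG.
have /cards2P[a [b [nab def_e]]] := forall_inP (edges_card2 G) e eG.
transitivity #|[set (a, b); (b, a)]|; last first.
  by rewrite cards2 xpair_eqE (negPf nab).
rewrite sum1_card; apply: eq_card => -[u v]; rewrite unfold_in /= !inE /= def_e eq_set2 andb_idl //.
by rewrite -eq_set2 -def_e => /eqP; rewrite /adj => ->.
Qed.

(* [D] is the double cover of [(G, s)], the bijection [p] identifying its
   vertices with signed vertices of [G]. *)
Definition is_cover (V W : finType) (p : W -> V * bool) (D : sgraph W)
    (G : sgraph V) (s : rel V) :=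
  forall x y, adj D x y =
    adj G (p x).1 (p y).1 && ((p x).2 (+) (p y).2 == s (p x).1 (p y).1).

Lemma card_cover_edges (V W : finType) (p : W -> V * bool) (D : sgraph W)
    (G : sgraph V) (s : rel V) :
  bijective p -> is_cover p D G s -> #|E(D)| = (2 * #|E(G)|)%N.
Proof.
move=> p_bij cov; have [q pK qK] := p_bij.
apply/eqP; rewrite -(eqn_pmul2r (isT : 0 < 2)%N) -mulnA -!card_arcs -card_bool mulnC.
rewrite -cardsT -cardsX; apply/eqP.
(* An arc of [G] has exactly one lift from each level of its initial vertex; the voltage determines
   the level of the end. *)
pose f (z : (V * V) * bool) := (q (z.1.1, z.2), q (z.1.2, z.2 (+) s z.1.1 z.1.2)).
have f_inj : injective f.
  move=> [[a b] i] [[c d] j] [] /(can_inj qK)[-> ->] /(can_inj qK)[-> _] //.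
rewrite -(card_imset _ f_inj); apply: eq_card => -[x y].
rewrite inE /= cov; apply/idP/imsetP=> [/andP[xy /eqP sxy] | [[[a b] i]]].
  exists ((p x).1, (p y).1, (p x).2); first by rewrite !inE /= xy.
  by rewrite /f /= -sxy addKb -!surjective_pairing !pK.
by rewrite !inE /= andbT => ab [-> ->]; rewrite !qK /= ab addKb eqxx.
Qed.

Lemma hexagon_freeP (V : finType) (G : sgraph V) :
  hexagons G = set0 <->
  forall a b c d e f, uniq [:: a; b; c; d; e; f] ->
    ~~ path.cycle (adj G) [:: a; b; c; d; e; f].
Proof.
split=> [/setP G0 a b c d e f Uc | noG].
  apply/negP=> cG; have := G0 (cycle_edges [:: a; b; c; d; e; f]).
  rewrite [RHS]inE => /negP; apply.
  by apply/cyclesP; exists [:: a; b; c; d; e; f].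
apply/setP=> C; rewrite [RHS]inE; apply/cyclesP.
by case=> [[|a [|b [|c [|d [|e [|f [|? ?]]]]]]] [] // _ /noG/negP].
Qed.

(** A vertex [y] has at most one neighbour in each fibre, because the voltage fixes the level of
    that neighbour. *)
Lemma cover_dist2 (V W : finType) (p : W -> V * bool) (D : sgraph W)
    (G : sgraph V) (s : rel V) x y z :
  injective p -> symmetric s -> is_cover p D G s ->
  adj D x y -> adj D y z -> x != z -> (p x).1 != (p z).1.
Proof.
move=> p_inj s_sym cov; rewrite !cov => /andP[_ /eqP sxy] /andP[_ /eqP syz].
apply: contra_neq => xz; apply: p_inj; apply/eqP; rewrite -pair_eqE /= xz eqxx /=.
move: sxy syz; rewrite xz s_sym => <-.
by do 3!case: (p _).2.
Qed.

(** If [x] and [w] shared a fibre, the path would project to a triangle of voltage zero, so their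
    levels would agree as well. *)
Lemma cover_dist3 (V W : finType) (p : W -> V * bool) (D : sgraph W)
    (G : sgraph V) (s : rel V) x y z w :
  injective p -> is_cover p D G s -> free_voltage G s ->
  adj D x y -> adj D y z -> adj D z w -> x != w -> (p x).1 != (p w).1.
Proof.
move=> p_inj cov [fT _]; rewrite !cov.
move=> /andP[xy /eqP sxy] /andP[yz /eqP syz] /andP[zw /eqP szw].
apply: contra_neq => xw; apply: p_inj; apply/eqP; rewrite -pair_eqE /= xw eqxx /=.
have := fT (p x).1 (p y).1 (p z).1; rewrite /= xy yz xw zw => /(_ isT).
by rewrite -xw -sxy -syz xw -szw; do 4!case: (p _).2.
Qed.

(* A closed walk of length 3 in [G] with odd voltage lifts to a path of length
   3 joining the two lifts of a vertex. *)
Lemma cover_hexagons (V W : finType) (p : W -> V * bool) (D : sgraph W)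
    (G : sgraph V) (s : rel V) :
  bijective p -> symmetric s -> is_cover p D G s ->
  hexagons D = set0 <-> free_voltage G s.
Proof.
move=> p_bij s_sym cov; have p_inj := bij_inj p_bij; have [q pK qK] := p_bij.
apply: iff_trans (hexagon_freeP D) _.
have cov_step u v i : adj G u v -> adj D (q (u, i)) (q (v, i (+) s u v)).
  by move=> uv; rewrite cov !qK /= uv addKb eqxx.
split=> [noD | [fT fH] a b c d e f Uc]; first split.
- move=> a b c /and4P[ab bc ca _]; apply/negbTE/negP=> odd_abc.
  (* One turn around an odd triangle leads from level [i] to level [~~ i], so two turns close up to
     a hexagon of [D]. *)
  pose x i := q (a, i); pose y i := q (b, i (+) s a b).
  pose z i := q (c, i (+) s a b (+) s b c).
  have xy i : adj D (x i) (y i) by apply: cov_step.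
  have yz i : adj D (y i) (z i) by apply: cov_step.
  have zx i : adj D (z i) (x (~~ i)).
    rewrite /x (_ : ~~ i = i (+) s a b (+) s b c (+) s c a); first exact: cov_step.
    by move: odd_abc; case: i; case: (s a b); case: (s b c); case: (s c a).
  have Uc : uniq [:: x true; y true; z true; x false; y false; z false].
    have := (adj_neq ab, adj_neq bc, adj_neq ca) => -[[nab nbc] nca].
    rewrite /= !inE !(can_eq qK) !xpair_eqE (eq_sym b a) (eq_sym c b).
    rewrite (eq_sym a c) (negPf nab) (negPf nbc) (negPf nca) !eqxx /=.
    by case: (s a b); case: (s b c).
  have /negP := noD _ _ _ _ _ _ Uc; apply.
  by rewrite /= !xy !yz (zx true) (zx false).
- move=> a b c d e f Uc /and5P[ab bc cd de /and3P[ef fa _]].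
  apply: contraT => even_abc.
  (* The levels of the lift starting at [(a, false)] are the partial sums of the voltages; an even
     total closes the lift. *)
  pose i1 := s a b; pose i2 := i1 (+) s b c; pose i3 := i2 (+) s c d.
  pose i4 := i3 (+) s d e; pose i5 := i4 (+) s e f.
  have Uq : uniq [:: q (a, false); q (b, i1); q (c, i2); q (d, i3); q (e, i4); q (f, i5)].
    by apply: (@map_uniq _ _ (fun w => (p w).1)); rewrite /= !qK.
  move: (noD _ _ _ _ _ _ Uq); rewrite /= !cov_step //=.
  by have := cov_step _ _ i5 fa; rewrite (negPf even_abc : i5 (+) s f a = false) => ->.
apply/negP=> /and5P[ab bc cd de /and3P[ef fa _]].
have n2 := cover_dist2 p_inj s_sym cov.
have n3 := cover_dist3 p_inj cov (conj fT fH).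
(* A hexagon of [D] projects to a hexagon of [G]: vertices at distance 1, 2 and 3 along it are kept
   apart by looplessness of [G], [n2] and [n3]. *)
have U1 : uniq (map (fun w => (p w).1) [:: a; b; c; d; e; f]).
  have nG x y : adj D x y -> (p x).1 != (p y).1.
    by rewrite cov => /andP[/adj_neq].
  move: Uc; rewrite /= !inE !negb_or -!andbA.
  case/and5P=> _ nac nad nae /and5P[_ _ nbd nbe /and5P[nbf _ nce ncf /and4P[_ ndf _ _]]].
  rewrite !(nG a b, nG b c, nG c d, nG d e, nG e f) //.
  rewrite (n2 a b c) // (n2 b c d) // (n2 c d e) // (n2 d e f) //.
  rewrite (n3 a b c d) // (n3 b c d e) // (n3 c d e f) //.
  rewrite (eq_sym (p a).1 (p e).1) (n2 e f a) 1?eq_sym //.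
  rewrite (eq_sym (p b).1 (p f).1) (n2 f a b) 1?eq_sym //.
  by rewrite eq_sym nG.
move: ab bc cd de ef fa; rewrite !cov.
move=> /andP[ab /eqP sab] /andP[bc /eqP sbc] /andP[cd /eqP scd].
move=> /andP[de /eqP sde] /andP[ef /eqP sef] /andP[fa /eqP sfa].
have := fH _ _ _ _ _ _ U1; rewrite /= ab bc cd de ef fa => /(_ isT).
(* Each level occurs twice around the cycle, so the voltages sum to zero, against [fH]. *)
by rewrite -sab -sbc -scd -sde -sef -sfa; do 6!case: (p _).2.
Qed.

(** * Deck transformations and admissible involutions *)

Definition flip (V : finType) (u : V * bool) := (u.1, ~~ u.2).

Lemma cover_exists (V W : finType) (p : W -> V * bool) (G : sgraph V)
    (s : rel V) :
  symmetric s -> exists D : sgraph W, is_cover p D G s.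
Proof.
move=> s_sym; apply: rel_graph => [x y | x]; last by rewrite adj_irr.
by rewrite adj_sym addbC s_sym.
Qed.

(** The involution exchanges the two levels of every fibre. Condition (i) holds as [G] has no loops,
    and (ii) as the voltage allows only one of [w] and [tau w] as a neighbour of [u]. *)
Lemma cover_admissible (V W : finType) (p : W -> V * bool) (D : sgraph W)
    (G : sgraph V) (s : rel V) :
  bijective p -> is_cover p D G s ->
  exists tau : {perm W}, admissible D tau.
Proof.
move=> p_bij cov; have p_inj := bij_inj p_bij; have [q pK qK] := p_bij.
pose t x := q (flip (p x)).
have tK : involutive t.
  by move=> x; rewrite /t qK /flip /= negbK -surjective_pairing pK.
have pt x : p (perm (can_inj tK) x) = flip (p x) by rewrite permE /t qK.
exists (perm (can_inj tK)); apply/and5P; split.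
- apply/forallP=> u; apply/forallP=> v.
  by rewrite !cov !pt /= addbN addNb negbK.
- by apply/forallP=> v; rewrite !permE tK.
- apply/forallP=> v; rewrite -(inj_eq p_inj) pt -pair_eqE /= negb_and orbC.
  by case: (p v).2.
- by apply/forallP=> v; rewrite cov pt /= adj_irr.
apply/forallP=> u; apply/forallP=> w; apply/implyP=> _; rewrite !cov !pt /=.
by apply/negP=> /and4P[/andP[_ /eqP <-] /andP[_]]; rewrite addbN; case: (_ (+) _).
Qed.

(** The smaller element of each orbit is put on level [false]. These elements form [A], which [tau]
    exchanges with its complement, so [A] has [n] elements and its enumeration labels the orbits. *)
Lemma involution_signed (n : nat) (tau : {perm 'I_(2 * n)}) :
  (forall x, tau (tau x) = x) -> (forall x, tau x != x) ->
  exists2 p : 'I_(2 * n) -> 'I_n * bool,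
    bijective p & forall x, p (tau x) = flip (p x).
Proof.
move=> tauK tau_fix; pose A := [set x : 'I_(2 * n) | (x < tau x)%N].
have tauA x : (tau x \in A) = (x \notin A).
  rewrite !inE tauK -leqNgt [RHS]leq_eqVlt orb_idl // => /eqP /val_inj tx.
  by have := tau_fix x; rewrite tx eqxx.
have cardA : #|A| = n.
  apply/eqP; rewrite -(eqn_pmul2l (isT : 0 < 2)%N) mul2n -addnn.
  rewrite -{2}(card_imset _ (@perm_inj _ tau)) -[X in _ == X]card_ord -(cardC A) eqn_add2l.
  apply/eqP/eq_card=> x; rewrite !inE; apply/imsetP/idP=> [[y yA ->]|xA].
    by have := tauA y; rewrite yA !inE => ->.
  by exists (tau x); rewrite ?tauK // tauA inE.
(* [enum_rank_in] requires an element of [A]. If there is none, then [n] is 0 and both types are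
   empty. *)
have [n0|[x0 x0A]] := set_0Vmem A.
  have no (x : 'I_(2 * n)) : False by have := tauA x; rewrite n0 !inE.
  exists (fun x => False_rect ('I_n * bool) (no x)) => [|x]; last by case: (no x).
  have noI (u : 'I_n * bool) : False.
    by case: u => -[i i_n] _; rewrite -cardA n0 cards0 in i_n.
  by exists (fun u => False_rect 'I_(2 * n) (noI u)) => [x|u]; [case: (no x)|case: (noI u)].
pose p x := if x \in A then (cast_ord cardA (enum_rank_in x0A x), false)
            else (cast_ord cardA (enum_rank_in x0A (tau x)), true).
pose q (u : 'I_n * bool) := let x := enum_val (cast_ord (esym cardA) u.1) in
                            if u.2 then tau x else x.
exists p => [|x]; last first.
  by rewrite /p tauA tauK; case: (x \in A).
exists q => [x|[i b]].
  rewrite /p /q; case: (boolP (x \in A)) => xA; rewrite /= cast_ordK enum_rankK_in ?tauK //.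
  by rewrite tauA xA.
have iA := enum_valP (cast_ord (esym cardA) i).
by rewrite /p /q; case: b => /=; rewrite ?tauA iA /= ?tauK enum_valK_in cast_ordKV.
Qed.

(** The base graph joins two orbits whenever [D] has an edge between them, with voltage [true] when
    the edge changes level. Invariance under [tau] makes adjacency depend only on the sum of the
    levels ([adjA]), and (i) excludes loops. *)
Lemma admissible_cover (n : nat) (D : sgraph 'I_(2 * n))
    (tau : {perm 'I_(2 * n)}) :
  admissible D tau ->
  exists p : 'I_(2 * n) -> 'I_n * bool, exists G : sgraph 'I_n, exists s,
    [/\ bijective p, symmetric s & is_cover p D G s].
Proof.
case/and5P=> /forallP tauD /forallP tauK /forallP tau_fix /forallP tau_adj /forallP tau4.
have [x|x|p p_bij ptau] := @involution_signed n tau; [exact/eqP/tauK | exact: tau_fix |].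
have [q pK qK] := p_bij.
pose A u v k := adj D (q (u, false)) (q (v, k)).
have tau_q u i : tau (q (u, i)) = q (u, ~~ i).
  by apply: (bij_inj p_bij); rewrite ptau !qK.
have tau_sym x y : adj D (tau x) (tau y) = adj D x y.
  by apply/eqP; move/forallP: (tauD x); apply.
have adjA u v i j : adj D (q (u, i)) (q (v, j)) = A u v (i (+) j).
  by case: i; rewrite /A // -tau_sym !tau_q.
have A_sym u v k : A u v k = A v u k by rewrite /A adj_sym adjA addbF.
have A_irr u k : A u u k = false.
  case: k; first by apply/negbTE; have := tau_adj (q (u, false)); rewrite tau_q.
  exact: adj_irr.
(* The voltage is well defined: if both values occurred, all four edges between the two orbits would
   be present, against (ii). *)
have A_excl u v : A u v true -> A u v false = false.
  have [-> | nuv Auv1] := eqVneq u v; first by rewrite !A_irr.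
  apply/negbTE/negP=> Auv0; move/forallP/(_ (q (v, false))): (tau4 (q (u, false))).
  rewrite !tau_q eq_set2 !xpair_eqE !(can_eq qK) !xpair_eqE (negPf nuv) /=.
  by rewrite !adjA Auv0 Auv1.
have [||G adjG] := @rel_graph _ (fun u v => A u v false || A u v true).
- by move=> u v; rewrite !(A_sym u).
- by move=> u; rewrite !A_irr.
exists p, G, (fun u v => A u v true); split=> // x y.
rewrite -{1}(pK x) -{1}(pK y) adjG; case: (p x) (p y) => [u i] [v j] /=.
rewrite adjA; case: (i (+) j); case: (A u v true) (@A_excl u v) => //= exc.
- by rewrite orbT.
- by rewrite orbF andbF.
- by rewrite exc // andbF.
- by rewrite orbF andbT.
Qed.

(** * Extremal numbers *)

Lemma R6_class (n : nat) :
  R6 n = (\max_(G : sgraph 'I_n | cohomology_class (omega G) == 1%g) #|E(G)|)%N.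
Proof.
have supp (G : sgraph 'I_n) :
    cohomology_class (omega G) = 1%g <-> supports_free_signing G.
  exact: iff_trans (cohomology_negative G) (iff_sym (supports_negative G)).
apply/eqP; rewrite eqn_leq; apply/andP; split; apply/bigmax_leqP.
  move=> [G sigma] /= fr; apply: (leq_bigmax_cond G).
  by apply/eqP/supp; exists sigma.
move=> G /eqP/supp[sigma fr].
exact: (leq_bigmax_cond (existT _ G sigma : signed_graph 'I_n)).
Qed.

Lemma R6_adm (n : nat) : ex_adm_C6 (2 * n) = (2 * R6 n)%N.
Proof.
rewrite R6_class; apply/eqP; rewrite eqn_leq; apply/andP; split.
  apply/bigmax_leqP=> D /andP[/eqP D6 /existsP[tau /admissible_cover]].
  case=> p [G [s [p_bij s_sym cov]]]; rewrite (card_cover_edges p_bij cov) leq_mul2l /=.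
  apply: leq_bigmax_cond; apply/eqP/cohomology_negative/negative_voltage.
  by exists s => //; apply/(cover_hexagons p_bij s_sym cov).
(* Moving the factor 2 across as a floor division leaves the maximum alone on the left, so that each
   [G] can be treated separately. *)
rewrite [X in (X <= _)%N]mulnC -leq_divRL //; apply/bigmax_leqP=> G /eqP/cohomology_negative/negative_voltage[s s_sym sG].
have card_I : #|{: 'I_n * bool}| = (2 * n)%N.
  by rewrite card_prod card_ord card_bool mulnC.
(* Any bijection serves: it only renames the vertices of the cover as ordinals. *)
pose p (x : 'I_(2 * n)) := enum_val (cast_ord (esym card_I) x) : 'I_n * bool.
have p_bij : bijective p.
  exists (fun u => cast_ord card_I (enum_rank u)) => u.
    by rewrite /p enum_valK cast_ordKV.
  by rewrite /p cast_ordK enum_rankK.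
have [D cov] := cover_exists p G s_sym.
rewrite leq_divRL // mulnC -(card_cover_edges p_bij cov).
apply: (leq_bigmax_cond D); rewrite ((proj2 (cover_hexagons p_bij s_sym cov)) sG) eqxx.
by apply/existsP; apply: cover_admissible p_bij cov.
Qed.

Theorem proposition5p2 :
  (forall (V : finType) (G : sgraph V),
     supports_free_signing G <-> cohomology_class (omega G) = 1%g) /\
  (forall (V : finType) (G : sgraph V),
     supports_free_signing G <->
     (forall Ts Hs : {set {set {set V}}},
        Ts \subset triangles G -> Hs \subset hexagons G ->
        symdiff (big_symdiff Ts) (big_symdiff Hs) = set0 ->
        ~~ odd #|Hs|)) /\
  (forall n : nat, (0 < n)%N ->
     R6 n = (\max_(G : sgraph 'I_n | cohomology_class (omega G) == 1%g)
               #|E(G)|)%N /\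
     (R6 n)%:R = 1 / 2 * (ex_adm_C6 (2 * n))%:R :> rat).
Proof.
split; first by move=> V G; apply: iff_trans (supports_negative G) (iff_sym (cohomology_negative G)).
split; first by move=> V G; apply: iff_trans (supports_negative G) (negative_families G).
move=> n _; split; first exact: R6_class.
by rewrite R6_adm natrM mul1r mulKf.
Qed.
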